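(* For any integer $n \geq 2$, the infinite-rank hypoplactic monoid $\mathsf{hypo}$ and the hypoplactic monoid $\mathsf{hypo}_n$ of rank $n$ satisfy exactly the same (monoid) identities.
   Context: Let $\mathcal{A} = \{1<2<3<\cdots\}$ be the ordered alphabet of positive integers and $\mathcal{A}_n = \{1<\cdots<n\}$. For a word $w$, $|w|_a$ is the number of occurrences of the letter $a$; the content of $w$ is the tuple $(|w|_a)_a$, and the support $\mathrm{supp}(w)$ is the set of letters occurring in $w$. A quasi-ribbon tableau is a finite grid of cells, aligned so that the leftmost cell in each row is below the rightmost cell of the previous row, filled with letters of $\mathcal{A}$ so that rows weakly increase from left to right and columns strictly increase from top to bottom. Krob--Thibon insertion of a letter $a$ into a quasi-ribbon tableau $T$: if no entry of $T$ is $\le a$, create a new cell $a$ and glue $T$ by its top-leftmost entry to the bottom of this cell; otherwise, let $x$ be the right-most and bottom-most entry of $T$ with $x \le a$, separate $T$ just after $x$, put a new entry $a$ to the right of $x$ and glue the remaining part of $T$ (below and to the right of $x$) onto the bottom of the new entry $a$. For $u \in \mathcal{A}^*$, $\mathrm{P}_{\mathsf{hypo}}(u)$ is the tableau obtained from the empty tableau by inserting the letters of $u$ from left to right. The hypoplactic congruence is: $u \equiv_{\mathsf{hypo}} v$ iff $\mathrm{P}_{\mathsf{hypo}}(u) = \mathrm{P}_{\mathsf{hypo}}(v)$. The hypoplactic monoid is $\mathsf{hypo} = \mathcal{A}^*/{\equiv_{\mathsf{hypo}}}$, and the hypoplactic monoid of rank $n$ is $\mathsf{hypo}_n = \mathcal{A}_n^*/{\equiv_{\mathsf{hypo}}}$.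 Known equivalent description (Novelli): $u \equiv_{\mathsf{hypo}} v$ iff $u$ and $v$ have the same content and the same inversions, where, if $\mathrm{supp}(u) = \{a_1<\dots<a_k\}$, $u$ has an $a_{i+1}$-$a_i$ inversion ($1 \le i \le k-1$) iff $a_{i+1}a_i$ is a (scattered) subsequence of $u$. A (monoid) identity over an alphabet of variables $X$ is a formal equality $u \approx v$ with $u,v \in X^*$. A monoid $M$ satisfies $u \approx v$ if $\psi(u) = \psi(v)$ for every monoid homomorphism $\psi: X^* \to M$. *)

(* Defs.v *)
From HB Require Import structures.
From mathcomp Require Import all_boot.

Set Implicit Arguments.
Unset Strict Implicit.
Unset Printing Implicit Defensive.

Local Open Scope quotient_scope.

(* The free monoid on X.  The library requires a choiceType under its monoids,
   but [baseUMagmaType], which is enough to speak of monoid morphisms out of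
   [word X], is available for an arbitrary type X of variables. *)
Definition word (X : Type) : Type := seq X.

HB.instance Definition _ (X : Type) := hasMul.Build (word X) (@cat X).
HB.instance Definition _ (X : Type) := hasOne.Build (word X) [::].
HB.instance Definition _ (X : choiceType) := Choice.copy (word X) (seq X).
HB.instance Definition _ (X : choiceType) :=
  Magma_isSemigroup.Build (word X) (@catA X).
HB.instance Definition _ (X : choiceType) :=
  BaseUMagma_isUMagma.Build (word X) (@cat0s X) (@cats0 X).

Definition satisfies (M : monoidType) (X : Type) (u v : word X) : Prop :=
  forall psi : UMagmaMorphism.type (word X) M, psi u = psi v.

(* A tableau is the list of its rows, from top to bottom.  Two vertically
   adjacent cells are always the last cell of a row and the first cell of the
   next one, so the grid is determined by the lengths of the rows. *)
Definition tableau := seq (seq nat).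

Definition quasi_ribbon (T : tableau) : bool :=
  all (fun r => (r != [::]) && sorted leq r) T
  && sorted (fun r s => last 0 r < head 0 s) T.

(* [k] is the number of cells of the row [r] up to and including its last cell
   with an entry at most [a]; it can be 0 only if the whole tableau has no such
   entry.  The part [drop k r :: T'], from which an empty row is discarded, is
   glued below the new cell. *)
Fixpoint kt_insert (T : tableau) (a : nat) : tableau :=
  if T is r :: T' then
    if has (has (fun x => x <= a)) T' then r :: kt_insert T' a else
    let k := size r - find (fun x => x <= a) (rev r) in
    rcons (take k r) a :: (if k < size r then drop k r :: T' else T')
  else [:: [:: a]].

Definition P_hypo (u : word nat) : tableau := foldl kt_insert [::] u.

(* The cells of [P_hypo u], read along the ribbon, form the sorted
   rearrangement of [u]; a new row starts between the adjacent entries x < y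
   exactly when u has a y-x inversion. *)

Definition inversion (u : word nat) (x y : nat) : bool := (x < y) && mem2 u y x.

Definition starts_row (d : rel nat) (x : nat) (s : seq nat) : bool :=
  if s is y :: _ then d x y else false.

Definition add_to_row (x : nat) (T : tableau) : tableau :=
  if T is r :: T' then (x :: r) :: T' else [:: [:: x]].

Fixpoint ribbon (d : rel nat) (s : seq nat) : tableau :=
  if s is x :: s' then
    if starts_row d x s' then [:: x] :: ribbon d s'
    else add_to_row x (ribbon d s')
  else [::].

Lemma flatten_add_to_row x T : flatten (add_to_row x T) = x :: flatten T.
Proof. by case: T. Qed.

Lemma flatten_ribbon d s : flatten (ribbon d s) = s.
Proof.
elim: s => //= x s IHs; case: ifP => _ /=; first by rewrite IHs.
by rewrite flatten_add_to_row IHs.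
Qed.

Lemma ribbon_ne d s : [::] \notin ribbon d s.
Proof.
elim: s => //= x s IHs; case: ifP => _; first by rewrite inE.
by case: (ribbon d s) IHs => [|r T] //=; rewrite !inE !negb_or => /andP[_ ->].
Qed.

Lemma has_flatten_ribbon d s (p : pred nat) : has (has p) (ribbon d s) = has p s.
Proof.
rewrite -[in RHS](flatten_ribbon d s); elim: (ribbon d s) => //= r T ->.
by rewrite has_cat.
Qed.

Lemma eq_ribbon d d' s : {in s &, d =2 d'} -> ribbon d s = ribbon d' s.
Proof.
elim: s => //= x s IHs dd'; rewrite IHs => [|y z ys zs]; last first.
  by rewrite dd' // inE ?ys ?zs orbT.
suff -> : starts_row d x s = starts_row d' x s by [].
by case: s {IHs} dd' => //= y s -> //; rewrite !inE eqxx ?orbT.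
Qed.

Lemma kt_insert_none T a :
  [::] \notin T -> ~~ has (has (fun x => x <= a)) T ->
  kt_insert T a = [:: a] :: T.
Proof.
case: T => //= r T; rewrite inE negb_or => /andP[r0 _].
rewrite negb_or => /andP[nr /negPf ->].
rewrite hasNfind ?has_rev // size_rev subnn take0 drop0 /=.
by case: r r0 {nr}.
Qed.

Lemma kt_insert_add_to_row T x a : x <= a ->
  kt_insert (add_to_row x T) a = add_to_row x (kt_insert T a).
Proof.
move=> xa; case: T => [|r T] /=; first by rewrite /= xa.
case: ifP => // _; rewrite rev_cons -[rcons (rev r) x]cats1 find_cat /= xa addn0.
have -> : (if has (fun y => y <= a) (rev r)
           then find (fun y => y <= a) (rev r) else size (rev r))
          = find (fun y => y <= a) (rev r).
  by case: ifPn => // /hasNfind ->.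
rewrite subSn ?ltnS /=; first by [].
by rewrite -(size_rev r) find_size.
Qed.

Lemma kt_insert_ribbon d d' a s1 s2 :
    all (fun x => x <= a) s1 -> all (fun x => a < x) s2 ->
    {in s1 &, d =2 d'} -> {in s2 &, d =2 d'} ->
    ~~ d' (last a s1) a -> all (d' a) s2 ->
  kt_insert (ribbon d (s1 ++ s2)) a = ribbon d' (s1 ++ a :: s2).
Proof.
move=> le1 gt2 dd1 dd2 d'1 d'2.
have no2 : has (fun x => x <= a) s2 = false.
  by apply/negbTE/hasPn => x /(allP gt2); rewrite ltnNge.
have ins2 : kt_insert (ribbon d s2) a = [:: a] :: ribbon d' s2.
  rewrite kt_insert_none ?ribbon_ne ?has_flatten_ribbon ?no2 //.
  by rewrite (eq_ribbon dd2).
have ins2' : [:: a] :: ribbon d' s2 = ribbon d' (a :: s2).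
  by case: (s2) d'2 => //= y s /andP[-> _].
elim: s1 le1 dd1 d'1 => [|x s1 IHs] /= le1 dd1 d'1; first by rewrite ins2.
case/andP: le1 => xa le1.
have {}IHs : ~~ d' (last a s1) a ->
    kt_insert (ribbon d (s1 ++ s2)) a = ribbon d' (s1 ++ a :: s2).
  apply: IHs => // y z ys zs.
  by rewrite dd1 // inE ?ys ?zs orbT.
case: s1 le1 dd1 d'1 IHs => [|y s1] /= le1 dd1 d'1 IHs.
  rewrite (negPf d'1) -[if starts_row d' a s2 then _ else _]/(ribbon d' (a :: s2)).
  rewrite -ins2' -ins2; case: ifP => [_|_]; last by rewrite kt_insert_add_to_row.
  rewrite ins2 /= has_flatten_ribbon no2 /= xa /=.
  by rewrite (eq_ribbon dd2).
rewrite -dd1 ?inE ?eqxx ?orbT //.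
rewrite -IHs; last by case: (s1) d'1.
case: ifP => _; last by rewrite kt_insert_add_to_row.
rewrite [LHS]/= -/(ribbon d (y :: (s1 ++ s2))) has_flatten_ribbon /=.
by case/andP: le1 => ->.
Qed.

Lemma inversion_rcons u a x y :
  inversion (rcons u a) x y = inversion u x y || [&& x < y, y \in u & x == a].
Proof.
rewrite /inversion -cats1 mem2_cat mem2_seq1 mem_seq1 -andb_orr.
case: ltnP => //= xy; case: (x =P a) => [<-|_]; last by rewrite !andbF orbF.
by rewrite gtn_eqF // orbF.
Qed.

Lemma inversion_cons u c x y :
  inversion (c :: u) x y = inversion u x y || [&& x < y, y == c & x \in u].
Proof.
rewrite /inversion mem2_cons -andb_orr [c == y]eq_sym.
case: ltnP => //= xy; case: eqP => [<-|_] /=; last by rewrite orbF.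
rewrite inE ltn_eqF //=; apply/idP/idP => [->|/orP[/mem2r|]//].
by rewrite orbT.
Qed.

Theorem P_hypoE u : P_hypo u = ribbon (inversion u) (sort leq u).
Proof.
elim/last_ind: u => // u a IHu.
rewrite /P_hypo -cats1 foldl_cat -/(P_hypo u) /= IHu cats1.
set le := fun x => x <= a; set gt := fun x => a < x.
set s1 := filter le (sort leq u); set s2 := filter gt (sort leq u).
have le1 : all le s1 by apply: filter_all.
have gt2 : all gt s2 by apply: filter_all.
have sort1 : sorted leq s1.
  by rewrite sorted_filter ?sort_sorted //; [apply: leq_trans|apply: leq_total].
have sort2 : sorted leq s2.
  by rewrite sorted_filter ?sort_sorted //; [apply: leq_trans|apply: leq_total].
have pairs : pairwise leq s1 && pairwise leq s2.
  by rewrite -!(sorted_pairwise leq_trans) sort1.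
have s12 : perm_eq (s1 ++ s2) u.
  rewrite perm_sym -(perm_sort leq) perm_sym /s1 /s2.
  have -> : filter gt (sort leq u) = filter (predC le) (sort leq u).
    by apply: eq_filter => x; rewrite /= /le -ltnNge.
  by apply/permPl/perm_filterC.
have sortu : sort leq u = s1 ++ s2.
  apply: (sorted_eq leq_trans anti_leq) => //.
  - exact: (sort_sorted leq_total).
  - rewrite (sorted_pairwise leq_trans) pairwise_cat pairs andbT.
    by apply/allrelP => x y /(allP le1) xa /(allP gt2) /ltnW; apply: leq_trans.
  - by rewrite perm_sort perm_sym.
have sortua : sort leq (rcons u a) = s1 ++ a :: s2.
  apply: (sorted_eq leq_trans anti_leq) => //.
  - exact: (sort_sorted leq_total).
  - rewrite (sorted_pairwise leq_trans) pairwise_cat /=.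
    case/andP: pairs => -> ->.
    have -> : all (leq a) s2 by apply: sub_all gt2 => x; apply: ltnW.
    rewrite !andbT; apply/allrelP => x y /(allP le1) xa.
    by rewrite inE => /predU1P[->//|/(allP gt2)/ltnW]; apply: leq_trans.
  - rewrite perm_sort perm_rcons perm_sym (perm_catCA s1 [:: a] s2).
    by rewrite perm_cons.
have memu x : x \in u = (x \in s1) || (x \in s2).
  by rewrite -(perm_mem s12) mem_cat.
rewrite sortu sortua; apply: kt_insert_ribbon => //.
- move=> x y xs ys; rewrite inversion_rcons.
  case: (x =P a) => [->|_]; last by rewrite !andbF orbF.
  by have:= allP le1 _ ys; rewrite /le leqNgt => /negPf->; rewrite orbF.
- move=> x y /(allP gt2) ax _; rewrite inversion_rcons.
  by rewrite gtn_eqF // !andbF orbF.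
- rewrite inversion_rcons negb_or; apply/andP; split.
    apply/negP => /andP[lta /mem2l]; rewrite memu => /orP[as1|/(allP gt2)];
      last by rewrite /gt ltnn.
    have: a <= last a s1.
      move: as1 sort1; case: (lastP s1) => // s z; rewrite last_rcons.
      rewrite mem_rcons inE => /predU1P[->//|as1].
      rewrite (sorted_pairwise leq_trans) pairwise_rcons => /andP[/allP az _].
      exact: az.
    by rewrite leqNgt lta.
  by apply/negP => /and3P[lta _ /eqP la]; rewrite la ltnn in lta.
- apply/allP => y ys; rewrite inversion_rcons memu ys eqxx orbT andbT.
  by have := allP gt2 _ ys; rewrite /gt => ->; rewrite orbT.
Qed.

Lemma P_hypo_quasi_ribbon u : quasi_ribbon (P_hypo u).
Proof.
rewrite P_hypoE; have := sort_sorted leq_total u.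
have: subrel (inversion u) ltn by move=> x y /andP[].
move: (inversion u) (sort leq u) => d s dlt.
have head_ribbon x r T t : ribbon d (x :: t) = r :: T -> head 0 r = x.
  by rewrite /=; case: ifP => _; [case=> <-|case: ribbon => [|? ?] [<-]].
elim: s => // x [|y s] // IHs s_sort.
have /andP[xy /IHs{IHs}] := s_sort.
rewrite -[ribbon d [:: x, y & s]]/(if d x y then [:: x] :: ribbon d (y :: s)
  else add_to_row x (ribbon d (y :: s))).
case E: (ribbon d (y :: s)) => [|r T].
  by have := flatten_ribbon d (y :: s); rewrite E.
have hr := head_ribbon _ _ _ _ E.
case/andP=> /= /andP[/andP[r0 rs] rT] TT; case: ifP => [/dlt /= dxy|_].
  by rewrite /quasi_ribbon /= r0 rs rT hr dxy.
case: r r0 rs TT hr {E} => //= z r _ rs TT hz.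
rewrite /quasi_ribbon /= rT hz xy -hz rs /=.
by case: T TT {rT}.
Qed.

Definition consecutive (u : word nat) (x y : nat) : bool :=
  [&& x \in u, y \in u, x < y & all (fun z => ~~ (x < z < y)) u].

Lemma perm_consecutive u v : perm_eq u v -> consecutive u =2 consecutive v.
Proof.
move=> uv x y.
by rewrite /consecutive !(perm_mem uv) (perm_all _ uv).
Qed.

Lemma ribbon_step d x y s :
  [/\ ribbon d [:: x, y & s] =
        if d x y then [:: x] :: ribbon d (y :: s)
        else add_to_row x (ribbon d (y :: s)),
      (size (head [::] (ribbon d [:: x, y & s])) == 1) = d x y
    & ribbon d (y :: s) =
        if ribbon d [:: x, y & s] is (_ :: r) :: T then
          if r is [::] then T else r :: T
        else [::]].
Proof.
have -> : ribbon d [:: x, y & s] = if d x y then [:: x] :: ribbon d (y :: s)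
  else add_to_row x (ribbon d (y :: s)) by [].
have := ribbon_ne d (y :: s).
case E: (ribbon d (y :: s)) => [|r T].
  by have := flatten_ribbon d (y :: s); rewrite E.
by case: ifP => // _; case: r {E}.
Qed.

Lemma ribbon_eqP d d' s :
    irreflexive d -> irreflexive d' -> sorted leq s ->
  ribbon d s = ribbon d' s <-> forall x y, consecutive s x y -> d x y = d' x y.
Proof.
move=> d0 d'0; elim: s => [|x [|y s] IHs].
- by move=> _; split.
- move=> _; split=> // _ y z; rewrite /consecutive !inE.
  by case/and4P => /eqP-> /eqP->; rewrite ltnn.
move=> s_sort; have /andP[xy /IHs{}IHs] := s_sort.
have x_min z : z \in y :: s -> x <= z.
  by apply: (allP (order_path_min leq_trans s_sort)).
have y_min z : z \in y :: s -> y <= z.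
  rewrite inE => /predU1P[->//|]; move: z; apply/allP.
  by case/andP: s_sort => _; apply: order_path_min leq_trans.
have [E1 s1 t1] := ribbon_step d x y s; have [E2 s2 t2] := ribbon_step d' x y s.
split=> [E z t|dd'].
  rewrite E in s1 t1; move: s1 t1; rewrite s2 -t2 => dxy /esym E'.
  have {}IHs := proj1 IHs (esym E').
  case/and4P; rewrite inE => /predU1P[->|zs]; rewrite inE.
    case/predU1P=> [->|ts]; first by rewrite ltnn.
    move=> xt btw; have := allP btw y; rewrite !inE eqxx orbT => /(_ isT).
    have := y_min _ ts; rewrite leq_eqVlt => /predU1P[<-//|yt].
    rewrite yt andbT -leqNgt => yx.
    have {yx}xy' : x = y by apply/eqP; rewrite eqn_leq xy.
    apply: IHs; rewrite /consecutive ts xt {1}xy' mem_head.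
    by case/andP: btw.
  case/predU1P=> [->|ts] zt.
    by have := x_min _ zs; rewrite leqNgt zt.
  case/andP=> _ btw; apply: IHs.
  by rewrite /consecutive zs ts zt.
have dxy : d x y = d' x y.
  move: xy; rewrite leq_eqVlt => /predU1P[->|xy]; first by rewrite d0 d'0.
  apply: dd'; rewrite /consecutive !inE !eqxx orbT xy /= ltnn /=.
  rewrite ltnn andbF /=; apply/allP => z zs.
  by rewrite negb_and -!leqNgt y_min ?orbT // inE zs orbT.
rewrite E1 E2 dxy; suff -> : ribbon d (y :: s) = ribbon d' (y :: s) by [].
apply: (proj2 IHs) => z t /and4P[zs ts zt btw]; apply: dd'.
rewrite /consecutive inE zs orbT inE ts orbT zt /= negb_and -leqNgt.
by rewrite x_min.
Qed.

Theorem P_hypo_eqP u v :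
  P_hypo u = P_hypo v <->
  perm_eq u v /\ forall x y, consecutive u x y -> mem2 u y x = mem2 v y x.
Proof.
have inv0 w : irreflexive (inversion w) by move=> x; rewrite /inversion ltnn.
have sortP : (sort leq u = sort leq v) <-> perm_eq u v.
  split=> [E|/(perm_sortP leq_total leq_trans anti_leq)//].
  exact/(perm_sortP leq_total leq_trans anti_leq).
have uu : perm_eq (sort leq u) u by rewrite perm_sort.
rewrite !P_hypoE; split=> [E|[/sortP E uv]].
  have Es : sort leq u = sort leq v.
    by have := congr1 flatten E; rewrite !flatten_ribbon.
  split; first exact/sortP.
  rewrite -Es in E; move/(ribbon_eqP _ _ (sort_sorted leq_total u)): E => E x y xy.
  have := E (inv0 u) (inv0 v) x y; rewrite (perm_consecutive uu) => /(_ xy).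
  by case/and4P: xy => _ _ xy _; rewrite /inversion xy.
rewrite -E; apply/ribbon_eqP => //; first exact: (sort_sorted leq_total).
move=> x y; rewrite (perm_consecutive uu) => xy.
by rewrite /inversion uv.
Qed.

Lemma P_hypo_catr u v w : P_hypo u = P_hypo v -> P_hypo (u ++ w) = P_hypo (v ++ w).
Proof. by rewrite /P_hypo !foldl_cat => ->. Qed.

Lemma P_hypo_catl w u v : P_hypo u = P_hypo v -> P_hypo (w ++ u) = P_hypo (w ++ v).
Proof.
elim: w => //= c w IHw /IHw/P_hypo_eqP[]; move: (w ++ u) (w ++ v) => {w IHw}u {}v.
move=> uv inv_uv; apply/P_hypo_eqP; rewrite perm_cons; split=> // x y.
case/and4P=> xs ys xy /= /andP[_ btw].
have := inversion_cons u c x y; have := inversion_cons v c x y.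
rewrite /inversion xy /= => -> ->; rewrite (perm_mem uv); congr (_ || _).
have [xu|xu] := boolP (x \in u); last first.
  by rewrite !mem2rf // -(perm_mem uv).
have [yu|yu] := boolP (y \in u); last first.
  by rewrite !mem2lf // -(perm_mem uv).
by apply: inv_uv; rewrite /consecutive xu yu xy.
Qed.

(* The alphabet {a : nat | S a} and the quotient of its free monoid by the
   hypoplactic congruence. *)
Definition letter (S : pred nat) := {a : nat | S a}.

Section HypoplacticMonoid.
Variable S : pred nat.

Definition hypo_congr (u v : word (letter S)) : bool :=
  P_hypo (map val u) == P_hypo (map val v).

Lemma hypo_congr_refl : reflexive hypo_congr.
Proof. by move=> u; apply: eqxx. Qed.

Lemma hypo_congr_sym : symmetric hypo_congr.
Proof. by move=> u v; apply: eq_sym. Qed.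

Lemma hypo_congr_trans : transitive hypo_congr.
Proof. by move=> v u w /eqP uv /eqP vw; apply/eqP; rewrite uv. Qed.

Canonical hypo_congr_equiv :=
  EquivRel hypo_congr hypo_congr_refl hypo_congr_sym hypo_congr_trans.

Definition hypo_over := {eq_quot hypo_congr}.

HB.instance Definition _ := Choice.on hypo_over.
HB.instance Definition _ := EqQuotient.on hypo_over.

Definition hypo_mul : hypo_over -> hypo_over -> hypo_over :=
  lift_op2 hypo_over (@cat (letter S)).
Definition hypo_one : hypo_over := \pi_hypo_over [::].

Lemma pi_hypo_mul : {morph \pi_hypo_over : u v / u ++ v >-> hypo_mul u v}.
Proof.
move=> u v; unlock hypo_mul; apply/eqmodP/eqP; rewrite !map_cat.
have reprP w : P_hypo (map val (repr (\pi_hypo_over w))) = P_hypo (map val w).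
  have : hypo_congr (repr (\pi_hypo_over w)) w by apply/eqmodP; rewrite reprK.
  by move/eqP.
rewrite (P_hypo_catr _ (esym (reprP u))).
by rewrite (P_hypo_catl _ (esym (reprP v))).
Qed.

Lemma hypo_mulA : associative hypo_mul.
Proof.
move=> a b c; rewrite -[a]reprK -[b]reprK -[c]reprK.
by rewrite -!pi_hypo_mul catA.
Qed.

Lemma hypo_mul1 : left_id hypo_one hypo_mul.
Proof. by move=> a; rewrite -[a]reprK -pi_hypo_mul. Qed.

Lemma hypo_mulr1 : right_id hypo_one hypo_mul.
Proof. by move=> a; rewrite -[a]reprK -pi_hypo_mul cats0. Qed.

HB.instance Definition _ :=
  isMonoid.Build hypo_over hypo_mulA hypo_mul1 hypo_mulr1.

End HypoplacticMonoid.

Definition hypo : monoidType := hypo_over (fun a => 0 < a).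

Definition hypo_rank (n : nat) : monoidType := hypo_over (fun a => 0 < a <= n).

(* Main.v *)
(** A substitution of words for the variables can be followed by the
    substitution that renames two letters a < b to 1 and 2 and erases all
    others.  This preserves the number of occurrences of a and whether ba is a
    scattered subsequence, and by Novelli's criterion these data, over all
    pairs a < b, determine the hypoplactic class.  So an identity that fails in
    hypo already fails on words over {1, 2}. *)
Require Import Defs.
From HB Require Import structures.
From mathcomp Require Import all_boot.

Definition subst {X : Type} (phi : X -> seq nat) (u : word X) : word nat :=
  flatten (map phi u).

Lemma subst_cat X (phi : X -> seq nat) u v :
  subst phi (u ++ v) = subst phi u ++ subst phi v.
Proof. by rewrite /subst map_cat flatten_cat. Qed.

Section SatisfiesHypo.
Variables (S : pred nat) (X : Type).

(** Entries outside [S] are dropped, so that [hypo_subst] below is a morphism for every [phi], with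
    no side condition. *)
Definition letters (s : seq nat) : seq (letter S) := pmap insub s.

Lemma val_letters s : all S s -> map val (letters s) = s.
Proof.
move=> /all_filterP {2}<-; rewrite pmap_filter; last exact: insubK.
by apply: eq_filter => a /=; rewrite isSome_insub.
Qed.

Section Induced.
Variable phi : X -> seq nat.

Definition hypo_subst (u : word X) : hypo_over S :=
  (\pi_(hypo_over S) (letters (subst phi u)))%qT.

Fact hypo_subst1 : hypo_subst 1%g = 1%g.
Proof. by []. Qed.

Fact hypo_substM : {morph hypo_subst : u v / (u * v)%g}.
Proof.
move=> u v; rewrite /hypo_subst (subst_cat _ _ u v) /letters pmap_cat.
exact: pi_hypo_mul.
Qed.

HB.instance Definition _ :=
  isMultiplicative.Build (word X) (hypo_over S) hypo_subst hypo_substM.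
HB.instance Definition _ :=
  Multiplicative_isUMagmaMorphism.Build (word X) (hypo_over S) hypo_subst
    hypo_subst1.

End Induced.

(** A morphism from a free monoid is determined by its values on the variables; [repr] chooses a
    word for each value. *)
Lemma morph_hypoE (psi : UMagmaMorphism.type (word X) (hypo_over S)) u :
  psi u = (\pi_(hypo_over S)
             (flatten [seq repr (psi [:: x] : hypo_over S) | x <- u]))%qT.
Proof.
elim: u => [|x u IHu]; first exact: (gmulf1 (s := psi)).
rewrite -[x :: u]/((([:: x] : word X) * (u : word X))%g) gmulfM IHu /= pi_hypo_mul reprK.
by [].
Qed.

(** This replaces morphisms into a quotient by substitutions of words over [nat], so that different
    alphabets [S] can be compared. *)
Lemma satisfies_hypoP (u v : word X) :
  satisfies (hypo_over S) u v <->
  forall phi : X -> seq nat, (forall x, all S (phi x)) ->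
    P_hypo (subst phi u) = P_hypo (subst phi v).
Proof.
split=> [uv phi Sphi|uv psi].
  have Ssubst w : all S (subst phi w).
    by elim: w => //= x w IHw; rewrite all_cat Sphi.
  have /eqmodP/eqP := uv (hypo_subst phi).
  by rewrite !val_letters.
rewrite !morph_hypoE; apply/eqmodP/eqP.
(* The substitution sends [x] to the letters of the chosen representative of [psi [:: x]]. *)
rewrite !map_flatten -!map_comp; apply: uv => x /=.
by apply/allP => _ /mapP[c _ ->]; apply: (valP c).
Qed.

End SatisfiesHypo.

Definition rename (a b : nat) (s : seq nat) : seq nat :=
  [seq if c == a then 1 else 2 | c <- s & (c == a) || (c == b)].

Lemma subst_rename X (phi : X -> seq nat) a b u :
  subst (rename a b \o phi) u = rename a b (subst phi u).
Proof.
by rewrite /subst /rename filter_flatten map_flatten -!map_comp.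
Qed.

Lemma count_rename a b s : count_mem 1 (rename a b s) = count_mem a s.
Proof.
elim: s => //= c s; rewrite /rename /=.
by case: (eqVneq c a) => [->|/negPf ca] /=; last case: eqP => _ /=;
  rewrite ?eqxx ?ca => ->.
Qed.

Lemma mem1_rename a b s : (1 \in rename a b s) = (a \in s).
Proof. by rewrite -!has_pred1 !has_count count_rename. Qed.

(** Erasing letters other than [a] and [b] does not affect whether [ba] is a scattered
    subsequence. *)
Lemma mem2_rename a b s : a < b -> mem2 (rename a b s) 2 1 = mem2 s b a.
Proof.
move=> ab; elim: s => //= c s IHs; have := mem1_rename a b s.
rewrite mem2_cons -IHs /rename /=; case: (eqVneq c a) => [->|ca] /=.
  by rewrite eqxx mem2_cons /= (ltn_eqF ab).
case: (eqVneq c b) => //= ->.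
by rewrite (gtn_eqF ab) mem2_cons /= !inE (ltn_eqF ab) /=.
Qed.

Lemma all_rename n a b s : 2 <= n -> all (fun c => 0 < c <= n) (rename a b s).
Proof.
move=> n2; apply/allP => _ /mapP[c _ ->].
by case: ifP; rewrite //= ltnW.
Qed.

Lemma P_hypo_renameP w w' :
  (forall a b, a < b -> P_hypo (rename a b w) = P_hypo (rename a b w')) ->
  P_hypo w = P_hypo w'.
Proof.
move=> ww'.
have E a b : a < b -> perm_eq (rename a b w) (rename a b w') /\
    mem2 w b a = mem2 w' b a.
  move=> ab; have /P_hypo_eqP[pE mE] := ww' a b ab; split=> //.
  rewrite -!(mem2_rename _ _ _ ab).
  (* If 1 or 2 is missing, neither word has the inversion. Otherwise 1 and 2 are consecutive in the
     support, even if [a] and [b] are not so in [w]. *)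
  have [w1|w1] := boolP (1 \in rename a b w); last first.
    by rewrite !mem2rf // -(perm_mem pE).
  have [w2|w2] := boolP (2 \in rename a b w); last first.
    by rewrite !mem2lf // -(perm_mem pE).
  apply: mE; rewrite /consecutive w1 w2 /=.
  by apply/allP => -[|[|[|z]]].
apply/P_hypo_eqP; split=> [|a b /and4P[_ _ ab _]]; last by have [] := E a b ab.
(* For the content any letter above [a] serves as partner; [a.+1] is one. *)
apply/allP => a _ /=; have [/permP/(_ (pred1 1))] := E a a.+1 (ltnSn a).
by rewrite !count_rename => ->.
Qed.

Theorem theorem3p7 (n : nat) (hn : 2 <= n) (X : Type) (u v : word X) :
  satisfies hypo u v <-> satisfies (hypo_rank n) u v.
Proof.
split=> /satisfies_hypoP uv; apply/satisfies_hypoP => phi Sphi.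
  (* Words over the first [n] letters are words over the full alphabet. *)
  by apply: uv => x; apply: sub_all (Sphi x) => a /andP[].
apply: P_hypo_renameP => a b ab; rewrite -!subst_rename.
by apply: uv => x; apply: all_rename.
Qed.
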